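(* Let $\alpha,\beta>-1$, let $w_J(x)=(1-x)^{\alpha}(1+x)^{\beta}w_0(x)$, $x\in[-1,1]$, be a Jacobi-type weight function as in the context, let $v_J(x):=-\ln w_J(x)$, and let $\{P_n\}$ be the associated monic orthogonal polynomials, with $h_n$, $\mathbf p(n)$, $\alpha_n$, $\beta_n$ as in the context. Then the ladder operators $$P_n'(z)=-B_n(z)P_n(z)+\beta_nA_n(z)P_{n-1}(z),$$ $$P_{n-1}'(z)=\bigl(B_n(z)+v_J'(z)\bigr)P_{n-1}(z)-A_{n-1}(z)P_n(z)$$ hold for $n\ge 0$, where $$A_n(z):=\frac{1}{1-z^2}\left[\frac{1}{h_n}\int_{-1}^{1}\frac{(1-z^2)v_J'(z)-(1-x^2)v_J'(x)}{z-x}P_n^2(x)w_J(x)\,dx+2n+1\right],\qquad n\ge 0,$$ with $A_{-1}(z):=0$, and $$B_n(z):=\frac{1}{1-z^2}\cdot\frac{1}{h_{n-1}}\int_{-1}^{1}\frac{(1-z^2)v_J'(z)-(1-x^2)v_J'(x)}{z-x}P_n(x)P_{n-1}(x)w_J(x)\,dx+\frac{nz-\mathbf p(n)}{1-z^2},\qquad n\ge 1,$$ with $B_0(z):=0$. Furthermore, $A_n(z)$ and $B_n(z)$ satisfy $$B_{n+1}(z)+B_n(z)=(z-\alpha_n)A_n(z)-v_J'(z),\qquad n\ge 0,$$ $$1+(z-\alpha_n)\bigl(B_{n+1}(z)-B_n(z)\bigr)=\beta_{n+1}A_{n+1}(z)-\beta_nA_{n-1}(z),\qquad n\ge 0,$$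 $$B_n^2(z)+v_J'(z)B_n(z)+\sum_{j=0}^{n-1}A_j(z)=\beta_nA_n(z)A_{n-1}(z),\qquad n\ge 1.$$
   Context: Weight: $w_0(x)$ is a continuously differentiable function, $w_0(x)>0$, and $w_0(x)$ is bounded at the endpoints $\pm1$ of $[-1,1]$; all moments $\int_{-1}^1x^jw_J(x)\,dx$, $j=0,1,\dots$, are finite. Polynomials: $P_0(x):=1$, $P_{-1}(x):=0$, and $P_j(x)=x^j+\mathbf p(j)x^{j-1}+\cdots+P_j(0)$, $j\ge1$, form the unique sequence of monic polynomials with $\int_{-1}^1P_i(x)P_j(x)w_J(x)\,dx=h_j\delta_{ij}$ for $i,j\ge0$ ($\delta_{ij}$ is the Kronecker delta); thus $\mathbf p(j)$ is the coefficient of $x^{j-1}$ in $P_j$, and $\mathbf p(0):=0$. They satisfy $xP_j(x)=P_{j+1}(x)+\alpha_jP_j(x)+\beta_jP_{j-1}(x)$, $j\ge0$, with $\alpha_j=\mathbf p(j)-\mathbf p(j+1)$ for $j\ge0$ and $\beta_j=h_j/h_{j-1}$ for $j\ge1$; terms containing $\beta_0$ are multiplied by $P_{-1}=0$ or $A_{-1}=0$. The recurrence coefficients $\alpha_n,\beta_n$ are distinct from the exponents $\alpha,\beta$. A prime denotes differentiation.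
   Formalization: The formal theorem takes z in (-1,1), where v_J' is defined, and additionally assumes that the integrals defining A_n(z) and B_n(z) converge absolutely at that z; for w_0 merely continuously differentiable they can diverge. *)

(* Defs.v *)
From mathcomp Require Import all_boot all_order all_algebra.
From mathcomp Require Import all_classical all_reals all_analysis.

Set Implicit Arguments.
Unset Strict Implicit.
Unset Printing Implicit Defensive.

Import Order.TTheory GRing.Theory Num.Theory.
Import numFieldNormedType.Exports.

Local Open Scope classical_set_scope.
Local Open Scope ring_scope.

(* [pre_term u n] is u_{n-1}, with the convention u_{-1} = 0. *)
Definition pre_term (V : zmodType) (u : nat -> V) (n : nat) : V :=
  if n is m.+1 then u m else 0.

Definition weight_factor (R : realType) (w0 : R -> R) : Prop :=
  [/\ {in `]-1, 1[, forall x, derivable w0 x 1},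
      {in `]-1, 1[, continuous (derive1 w0)},
      {in `]-1, 1[, forall x, 0 < w0 x},
      bounded_near w0 (at_right (-1)) &
      bounded_near w0 (at_left 1)].

Definition jacobi_weight (R : realType) (a b : R) (w0 : R -> R) (x : R) : R :=
  (1 - x) `^ a * (1 + x) `^ b * w0 x.

Definition potential (R : realType) (w : R -> R) (x : R) : R := - ln (w x).

Definition finite_moments (R : realType) (w : R -> R) : Prop :=
  forall j : nat, (@lebesgue_measure R).-integrable `[-1, 1]
    (EFin \o (fun x => x ^+ j * w x)).

Definition monic_orthogonal (R : realType) (w : R -> R)
    (P : nat -> {poly R}) (h : nat -> R) : Prop :=
  [/\ forall n, P n \is monic,
      forall n, size (P n) = n.+1 &
      forall i j, \int[lebesgue_measure]_(x in `[-1, 1])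
        ((P i).[x] * (P j).[x] * w x) = h i *+ (i == j)].

(* The coefficient bold-p(n) of x^(n-1) in P_n, with bold-p(0) = 0. *)
Definition subcoef (R : realType) (P : nat -> {poly R}) (n : nat) : R :=
  if n is m.+1 then (P n)`_m else 0.

Definition rec_alpha (R : realType) (P : nat -> {poly R}) (n : nat) : R :=
  subcoef P n - subcoef P n.+1.

(* The value at n = 0 is a dummy: beta_0 only ever multiplies P_{-1} = 0 or
   A_{-1} = 0. *)
Definition rec_beta (R : realType) (h : nat -> R) (n : nat) : R :=
  h n / h n.-1.

(* At the single point x = z the quotient takes the junk value 0. *)
Definition ladder_kernel (R : realType) (w : R -> R) (z x : R) : R :=
  ((1 - z ^+ 2) * derive1 (potential w) z
   - (1 - x ^+ 2) * derive1 (potential w) x) / (z - x).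

Definition ladderA_integrand (R : realType) (w : R -> R) (P : nat -> {poly R})
    (n : nat) (z x : R) : R :=
  ladder_kernel w z x * (P n).[x] ^+ 2 * w x.

Definition ladderB_integrand (R : realType) (w : R -> R) (P : nat -> {poly R})
    (n : nat) (z x : R) : R :=
  ladder_kernel w z x * (P n).[x] * (pre_term P n).[x] * w x.

(* Convergence at z of all the integrals in [ladderA] and [ladderB]; without it
   they are only dummy values.  It is not automatic for w0 merely C^1: the
   difference quotient of (1 - x^2) v'(x) at z need not be integrable. *)
Definition ladder_convergent (R : realType) (w : R -> R)
    (P : nat -> {poly R}) (z : R) : Prop :=
  (forall n, (@lebesgue_measure R).-integrable `[-1, 1]
     (EFin \o ladderA_integrand w P n z)) /\
  (forall n, (0 < n)%N -> (@lebesgue_measure R).-integrable `[-1, 1]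
     (EFin \o ladderB_integrand w P n z)).

Definition ladderA (R : realType) (w : R -> R) (P : nat -> {poly R})
    (h : nat -> R) (z : R) (n : nat) : R :=
  (1 - z ^+ 2)^-1 *
  ((h n)^-1 * \int[lebesgue_measure]_(x in `[-1, 1]) ladderA_integrand w P n z x
   + (2 * n + 1)%:R).

Definition ladderB (R : realType) (w : R -> R) (P : nat -> {poly R})
    (h : nat -> R) (z : R) (n : nat) : R :=
  if n is m.+1 then
    (1 - z ^+ 2)^-1 * (h m)^-1
      * \int[lebesgue_measure]_(x in `[-1, 1]) ladderB_integrand w P n z x
    + (n%:R * z - subcoef P n) / (1 - z ^+ 2)
  else 0.

(* Main.v *)
(* With L(q) the integral of q w and M(q) the integral of K(z, .) q w, where K is
   the kernel in A_n and B_n, improper integration by parts (the boundary terms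
   (1 - x^2) q w vanish as a, b > -1) gives
     M((z - X) q) = (1 - z^2) v'(z) L(q) - L(((1 - X^2) q)').
   Taking q = P_n^2 and q = P_n (P_{n+1} - beta_n P_{n-1}), and evaluating the
   right-hand side by orthogonality, yields the first two compatibility
   conditions at the point z itself.  The ladder relations then follow by
   induction from the three-term recurrence and its derivative, without the
   Christoffel-Darboux formula, and the third condition is obtained by
   multiplying the second by A_n and telescoping. *)
From HB Require Import structures.
Require Import Defs.
From mathcomp Require Import all_boot all_order all_algebra.
From mathcomp Require Import all_classical all_reals all_analysis.
From mathcomp Require Import ring lra zify.

Set Implicit Arguments.
Unset Strict Implicit.
Unset Printing Implicit Defensive.

Import Order.TTheory GRing.Theory Num.Theory.
Import numFieldNormedType.Exports.

Local Open Scope classical_set_scope.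
Local Open Scope ring_scope.

(** * Integration on [-1, 1]: fundamental theorem, linearity, positivity *)

Section WeightedIntegrals.
Variable R : realType.
Notation mu := (@lebesgue_measure R).
Implicit Types (f F : R -> R) (p q : {poly R}).

(** This is the improper version: [f] may blow up at both ends. The integral function [G] is
    continuous up to the ends and [F - G] has zero derivative inside, so by the mean value theorem
    [F - G] takes the same value at [a] and [b]. *)
Lemma integrable_FTC2 f F (a b : R) : a < b ->
  mu.-integrable `[a, b] (EFin \o f) ->
  {in `]a, b[, continuous f} ->
  derivable_oo_LRcontinuous F a b ->
  {in `]a, b[, derive1 F =1 f} ->
  \int[mu]_(x in `[a, b]) f x = F b - F a.
Proof.
move=> ab fi cf dF F'f.
pose G x := \int[mu]_(t in `[a, x]) f t.
have dG x : x \in `]a, b[ -> derivable G x 1 /\ derive1 G x = f x.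
  move=> xab; move: (xab); rewrite in_itv /= => /andP[ax xb].
  by have := continuous_FTC1_closed xb fi ax (cf x xab).
have cG : {within `[a, b], continuous G}.
  exact: parameterized_integral_continuous (ltW ab) fi.
have cF := derivable_oo_LRcontinuous_within dF.
have dFG x : x \in `]a, b[ -> is_derive x (1 : R) (F - G) 0.
  move=> xab; have [dGx Gx] := dG x xab; case: dF => dF' _ _.
  apply: DeriveDef; first exact: derivableB (dF' x xab) dGx.
  by rewrite (deriveB (dF' x xab) dGx) -!derive1E Gx F'f// subrr.
have [|c cab] := MVT ab dFG.
  by move=> x; apply: cvgB; [exact: cF|exact: cG].
rewrite mul0r => /eqP; rewrite subr_eq0 => /eqP.
rewrite !fctE {2}/G set_itv1 Rintegral_set1 subr0 -/(G b) => <-.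
by rewrite opprB addrC subrK.
Qed.

Lemma cvg0M_bounded (T : Type) (D : set_system T) (f g : T -> R) : Filter D ->
  f @ D --> (0 : R) -> bounded_near g D -> (fun x => f x * g x) @ D --> (0 : R).
Proof.
move=> FD f0 /ex_strict_bound_gt0 [M M0 gM].
apply/cvgrPdist_lt => e e0.
move/cvgrPdist_lt : f0 => /(_ (e / M) (divr_gt0 e0 M0)) fe.
near=> x; rewrite sub0r normrN normrM.
have fx : `|f x| < e / M by rewrite -normrN -sub0r; near: x.
have gx : `|g x| < M by near: x.
by rewrite -(divfK (lt0r_neq0 M0) e) ltr_pM.
Unshelve. all: by end_near. Qed.

Lemma cvg_1D_at_right : (1 + x) @[x --> (-1)^'+] --> (0 : R)^'+.
Proof.
move=> S [e /= e0 eS]; exists e => //= y.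
rewrite /ball_ /= => ye y1; apply: eS => /=; last by lra.
by rewrite sub0r normrN -normrN opprD.
Qed.

Lemma cvg_1B_at_left : (1 - x) @[x --> 1^'-] --> (0 : R)^'+.
Proof.
move=> S [e /= e0 eS]; exists e => //= y.
rewrite /ball_ /= => ye y1; apply: eS => /=; last by lra.
by rewrite sub0r normrN.
Qed.

Lemma is_derive_powR_comp f (c x df : R) : 0 < f x ->
  is_derive x (1 : R) f df ->
  is_derive x (1 : R) (fun y => f y `^ c) (c * f x `^ (c - 1) * df).
Proof.
move=> fx dfx; have := is_derive1_powR c fx => dpow.
by have := @is_derive1_comp _ (fun y => y `^ c) f x _ _ dpow dfx.
Qed.

Lemma integrable_horner_mul p f : mu.-integrable `[-1, 1] (EFin \o f) ->
  mu.-integrable `[-1, 1] (EFin \o (fun x => p.[x] * f x)).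
Proof.
move=> fi; have mD : measurable (`[-1, 1] : set R) by [].
have mp : measurable_fun (`[-1, 1] : set R) (horner p).
  exact: measurable_poly.
have bp : [bounded p.[x] | x in (`[-1, 1] : set R)].
  have /compact_bounded : compact (horner p @` (`[-1, 1] : set R)).
    apply: continuous_compact; last exact: segment_compact.
    exact/continuous_subspaceT/continuous_horner.
  move=> [M [Mr MA]]; exists M; split => // y My x xD.
  by apply: MA => //; exists x.
exact: (@integrableMr _ _ _ mu _ mD (horner p) (EFin \o f) mp bp fi).
Qed.

(** Packaging the integral as a linear form on polynomials turns the later orthogonality arguments
    into pure algebra. *)
Lemma weighted_integral_linear f : mu.-integrable `[-1, 1] (EFin \o f) ->
  exists L : {scalar {poly R}},
    forall p, L p = \int[mu]_(x in `[-1, 1]) (p.[x] * f x).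
Proof.
move=> fi; have mD : measurable (`[-1, 1] : set R) by [].
pose L0 p : R := \int[mu]_(x in `[-1, 1]) (p.[x] * f x).
have linL : linear_for *%R L0.
  move=> c p q; rewrite /L0 -RintegralZl//; last exact: integrable_horner_mul.
  rewrite -RintegralD//; [|exact: integrableZl (integrable_horner_mul p fi)|].
    by apply: eq_Rintegral => x _; rewrite hornerD hornerZ mulrDl mulrA.
  exact: integrable_horner_mul.
pose lin0 := GRing.isLinear.Build R {poly R} R *%R L0 linL.
pose L : {scalar {poly R}} := HB.pack L0 lin0.
by exists L.
Qed.

Lemma finite_roots p : p != 0 -> finite_set [set x | root p x].
Proof.
move=> p0; apply: contrapT => /(infinite_set_fset (size p))[B Bp].
have : all (root p) (finmap.enum_fset B) by apply/allP => x xB; exact: Bp.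
by move/(max_poly_roots p0)/(_ (finmap.fset_uniq B)); rewrite ltnNge => /negP.
Qed.

(** This gives h_n <> 0. If the integral were 0, the nonnegative integrand would vanish almost
    everywhere; it vanishes inside only at the finitely many roots of [p], so the open interval
    would be negligible, although its measure is 2. *)
Lemma weighted_square_neq0 f p : mu.-integrable `[-1, 1] (EFin \o f) ->
  {in `]-1, 1[, forall x, 0 < f x} -> p != 0 ->
  \int[mu]_(x in `[-1, 1]) ((p * p).[x] * f x) != 0.
Proof.
move=> fi f0 p0; apply/eqP => int0.
pose g x := (p * p).[x] * f x.
have gi : mu.-integrable `[-1, 1] (EFin \o g) by exact: integrable_horner_mul.
have gio : mu.-integrable `]-1, 1[ (EFin \o g).
  by apply: integrableS gi => //; exact: subset_itv_oo_cc.
have gioc : mu.-integrable `]-1, 1] (EFin \o g).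
  by apply: integrableS gi => //; exact: subset_itv_oc_cc.
have g_ge0 (x : R) : x \in `]-1, 1[ -> 0 <= g x.
  move=> xI; rewrite /g hornerM -expr2 mulr_ge0 ?sqr_ge0//; exact/ltW/f0.
(* Positivity of [f] is known only inside, so the two endpoints are dropped. *)
have int0' : \int[mu]_(x in `]-1, 1[) g x = 0.
  by rewrite Rintegral_itv_bndo_bndc// Rintegral_itv_obnd_cbnd.
pose I : set R := `]-1, 1[%classic.
have : (\int[mu]_(x in I) `|(g x)%:E| = 0)%E.
  rewrite -[0%E]/(0%:E) -int0' /Rintegral fineK; last exact: integrable_fin_num.
  apply: eq_integral => x; rewrite inE /= => xI.
  by rewrite ger0_norm// g_ge0.
have mg := measurable_int mu gio.
move/(ae_eq_integral_abs mu (measurable_itv _) mg) => ae0.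
have : mu.-negligible (`]-1, 1[ : set R).
  have /negligibleU := ae0.
  have nroots : mu.-negligible [set x | root p x].
    apply/negligibleP.
      exact/countable_measurable/finite_set_countable/finite_roots.
    exact/countable_lebesgue_measure0/finite_set_countable/finite_roots.
  move=> /(_ _ nroots); apply: negligibleS => x xI.
  have [px|px] := boolP (root p x); [by right|left => /= H].
  have := H xI => /= /eqP; rewrite eqe /g hornerM !mulf_eq0 -/(root p x).
  by rewrite (negbTE px) /= gt_eqF// f0.
move/negligibleP => /(_ (measurable_itv _)).
rewrite /= lebesgue_measure_itv /= lte_fin ifT; last by lra.
by rewrite -EFinB => /eqP; rewrite eqe; apply/negP; rewrite gt_eqF//; lra.
Qed.

End WeightedIntegrals.

(** * Jacobi-type weights: derivative, boundary behaviour, integration by parts *)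

Section JacobiWeight.
Variable R : realType.
Notation mu := (@lebesgue_measure R).
Implicit Types q : {poly R}.

Variables (a b : R) (w0 : R -> R).
Hypotheses (a1 : -1 < a) (b1 : -1 < b) (w0P : weight_factor w0).
Let w := jacobi_weight a b w0.

(** The derivative of [w], written as [w] times its logarithmic derivative, so that dividing by [w]
    leaves -v'. At the endpoints it is only a default value. *)
Let dw x := w x * (b / (1 + x) - a / (1 - x) + derive1 w0 x / w0 x).

Let oo (x : R) : x \in `]-1, 1[ -> 0 < 1 - x /\ 0 < 1 + x.
Proof. by rewrite in_itv /= => /andP[? ?]; split; lra. Qed.

Lemma jacobi_weight_gt0 (x : R) : x \in `]-1, 1[ -> 0 < w x.
Proof.
case: w0P => _ _ w0gt _ _ xI; have [x1 x2] := oo xI.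
by rewrite /w /jacobi_weight !mulr_gt0 ?powR_gt0 ?w0gt.
Qed.

Lemma is_derive_jacobi_weight (x : R) : x \in `]-1, 1[ ->
  is_derive x (1 : R) w (dw x).
Proof.
case: w0P => dw0 _ w0gt _ _ xI; have [x1 x2] := oo xI.
have d0 : is_derive x (1 : R) w0 (derive1 w0 x).
  by rewrite derive1E; apply: DeriveDef => //; exact: dw0.
have da : is_derive x (1 : R) (fun y => 1 - y) (-1).
  by apply: is_derive_eq; ring.
have db : is_derive x (1 : R) (fun y => 1 + y) 1.
  by apply: is_derive_eq; ring.
have pa := @is_derive_powR_comp R (fun y : R => 1 - y) a x _ x1 da.
have pb := @is_derive_powR_comp R (fun y : R => 1 + y) b x _ x2 db.
rewrite (_ : dw x = ((1 - x) `^ a * (1 + x) `^ b) *: derive1 w0 x + w0 x *: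
  ((1 - x) `^ a *: (b * (1 + x) `^ (b - 1) * 1)
   + (1 + x) `^ b *: (a * (1 - x) `^ (a - 1) * -1))).
  exact: is_deriveM (is_deriveM pa pb) d0.
rewrite /dw /w /jacobi_weight /GRing.scale /=.
rewrite !powRB ?(gt_eqF x1) ?(gt_eqF x2) ?implybT// !powRr1 ?ltW//.
by field; rewrite !gt_eqF// w0gt.
Qed.

Lemma continuous_jacobi_weight_deriv : {in `]-1, 1[, continuous dw}.
Proof.
case: (w0P) => dw0 cdw0 w0gt _ _ x xI; have [x1 x2] := oo xI.
have cw0 : {for x, continuous w0}.
  by apply/differentiable_continuous/derivable1_diffP/dw0.
have cw : {for x, continuous w}.
  apply/differentiable_continuous/derivable1_diffP.
  by have [] := is_derive_jacobi_weight xI.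
apply: cvgM; first exact: cw.
apply: cvgD.
  apply: cvgB; apply: cvgM; [exact: cvg_cst| |exact: cvg_cst|].
    apply: cvgV; first by rewrite gt_eqF.
    by apply: cvgD; [exact: cvg_cst|exact: cvg_id].
  apply: cvgV; first by rewrite gt_eqF.
  by apply: cvgB; [exact: cvg_cst|exact: cvg_id].
apply: cvgM; first exact: cdw0.
by apply: cvgV; [rewrite gt_eqF// w0gt|exact: cw0].
Qed.

Lemma potential_deriv (x : R) : x \in `]-1, 1[ ->
  derive1 (potential w) x = - (dw x / w x).
Proof.
move=> xI; have w_gt0 := jacobi_weight_gt0 xI.
have dwx := is_derive_jacobi_weight xI.
have dln := is_derive1_ln w_gt0.
have := @is_derive1_comp _ (@ln R) w x _ _ dln dwx => dlnw.
have := is_deriveN dlnw => -[_].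
by rewrite derive1E /potential mulrC.
Qed.

(** The factor 1 - x^2 raises both exponents by one. As a, b > -1 they become positive, so at each
    endpoint one power tends to 0 while [w0] stays bounded. *)
Lemma quad_weightE (x : R) : x \in `]-1, 1[ ->
  (1 - x ^+ 2) * w x = (1 + x) `^ (b + 1) * (1 - x) `^ (a + 1) * w0 x.
Proof.
move=> xI; have [x1 x2] := oo xI.
rewrite /w /jacobi_weight !powRD ?(gt_eqF x1) ?(gt_eqF x2) ?implybT//.
by rewrite !powRr1 ?ltW//; ring.
Qed.

Lemma cvg_quad_weight_right :
  (1 - x ^+ 2) * w x @[x --> (-1)^'+] --> (0 : R).
Proof.
case: w0P => _ _ _ bw _.
have c1 : (1 + x) `^ (b + 1) @[x --> (-1)^'+] --> (0 : R).
  have b10 : 0 < b + 1 by rewrite -ltrBlDr sub0r.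
  exact: cvg_comp (@cvg_1D_at_right R) (powR_cvg0 b10).
have c2 : {for (-1 : R), continuous (fun x : R => (1 - x) `^ (a + 1))}.
  apply/differentiable_continuous/derivable1_diffP.
  have da : is_derive (-1 : R) (1 : R) (fun y : R => 1 - y) (-1).
    by apply: is_derive_eq; ring.
  have p2 : 0 < 1 - -1 :> R by rewrite opprK addr_gt0.
  by have [] := @is_derive_powR_comp R (fun y : R => 1 - y) (a + 1) (-1) _ p2 da.
have c12 : (1 + x) `^ (b + 1) * (1 - x) `^ (a + 1) @[x --> (-1)^'+] --> (0 : R).
  rewrite -(mul0r ((1 - -1 : R) `^ (a + 1))).
  apply: cvgM c1 _; exact: cvg_at_right_filter c2.
apply: cvg_trans (cvg0M_bounded _ c12 bw).
apply: near_eq_cvg; near=> x; rewrite quad_weightE// in_itv/=.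
by apply/andP; split; near: x; [exact: nbhs_right_gt|exact: nbhs_right_lt].
Unshelve. all: by end_near. Qed.

Lemma cvg_quad_weight_left :
  (1 - x ^+ 2) * w x @[x --> 1^'-] --> (0 : R).
Proof.
case: w0P => _ _ _ _ bw.
have c1 : (1 - x) `^ (a + 1) @[x --> 1^'-] --> (0 : R).
  have a10 : 0 < a + 1 by rewrite -ltrBlDr sub0r.
  exact: cvg_comp (@cvg_1B_at_left R) (powR_cvg0 a10).
have c2 : {for (1 : R), continuous (fun x : R => (1 + x) `^ (b + 1))}.
  apply/differentiable_continuous/derivable1_diffP.
  have db : is_derive (1 : R) (1 : R) (fun y : R => 1 + y) 1.
    by apply: is_derive_eq; ring.
  have p2 : 0 < 1 + 1 :> R by rewrite addr_gt0.
  by have [] := @is_derive_powR_comp R (fun y : R => 1 + y) (b + 1) 1 _ p2 db.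
have c12 : (1 + x) `^ (b + 1) * (1 - x) `^ (a + 1) @[x --> 1^'-] --> (0 : R).
  rewrite -(mulr0 ((1 + 1 : R) `^ (b + 1))).
  apply: cvgM c1; exact: cvg_at_left_filter c2.
apply: cvg_trans (cvg0M_bounded _ c12 bw).
apply: near_eq_cvg; near=> x; rewrite quad_weightE// in_itv/=.
by apply/andP; split; near: x; [exact: nbhs_left_gt|exact: nbhs_left_lt].
Unshelve. all: by end_near. Qed.

Lemma horner_quadM q (x : R) :
  ((1 - 'X^2) * q).[x] = (1 - x ^+ 2) * q.[x].
Proof. by rewrite !hornerE. Qed.

(** The values at -1 and 1 are 0 because of the factor 1 - x^2, whatever [w] is there, and they
    agree with the one-sided limits. *)
Lemma quad_mul_boundary q :
  derivable_oo_LRcontinuous (fun x => ((1 - 'X^2) * q).[x] * w x) (-1) 1.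
Proof.
have FE : (fun x => ((1 - 'X^2) * q).[x] * w x)
    = (fun x => q.[x] * ((1 - x ^+ 2) * w x)).
  by apply/funext => x; rewrite horner_quadM mulrAC mulrC.
rewrite FE; split.
- move=> x xI; have [dwx _] := is_derive_jacobi_weight xI.
  apply: derivableM; first exact: derivable_horner.
  have dquad := @derivable_horner R (1 - 'X^2) x.
  have quadE : horner (1 - 'X^2) = (fun y : R => 1 - y ^+ 2).
    by apply/funext => y; rewrite !hornerE.
  by rewrite quadE in dquad; exact: derivableM.
- rewrite (_ : q.[-1] * _ = q.[-1] * 0); last by rewrite sqrrN expr1n subrr mul0r.
  apply: cvgM cvg_quad_weight_right.
  exact/cvg_at_right_filter/continuous_horner.
- rewrite (_ : q.[1] * _ = q.[1] * 0); last by rewrite expr1n subrr mul0r.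
  apply: cvgM cvg_quad_weight_left.
  exact/cvg_at_left_filter/continuous_horner.
Qed.

(** The fundamental theorem applied to (1 - x^2) q w, which vanishes at both ends. The second
    integrability is assumed because continuity of w0' inside does not control it near the ends. *)
Lemma quad_integration_by_parts q : mu.-integrable `[-1, 1] (EFin \o w) ->
  mu.-integrable `[-1, 1] (EFin \o (fun x => ((1 - 'X^2) * q).[x] * dw x)) ->
  \int[mu]_(x in `[-1, 1]) (((1 - 'X^2) * q).[x] * dw x) =
  - \int[mu]_(x in `[-1, 1]) (((1 - 'X^2) * q)^`().[x] * w x).
Proof.
move=> wi dwi; set p := _ * q.
pose F x := p.[x] * w x.
pose f x := p.[x] * dw x + p^`().[x] * w x.
have pwi := integrable_horner_mul p^`() wi.
have fi : mu.-integrable `[-1, 1] (EFin \o f) by exact: integrableD dwi pwi.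
have dF (x : R) : x \in `]-1, 1[ -> is_derive x (1 : R) F (f x).
  move=> xI; have dwx := is_derive_jacobi_weight xI.
  have := is_deriveM (is_derive_poly p x) dwx.
  by rewrite /GRing.scale /= [w x * _]mulrC.
have cf : {in `]-1, 1[, continuous f}.
  move=> x xI; apply: cvgD; apply: cvgM; try exact: continuous_horner.
    exact: continuous_jacobi_weight_deriv.
  have [dwx _] := is_derive_jacobi_weight xI.
  exact/differentiable_continuous/derivable1_diffP.
have F'f : {in `]-1, 1[, derive1 F =1 f}.
  by move=> x /dF[_ <-]; rewrite derive1E.
have lt11 : -1 < 1 :> R by lra.
have := integrable_FTC2 lt11 fi cf (quad_mul_boundary q) F'f.
rewrite /f RintegralD//= => E; apply/eqP; rewrite -addr_eq0 E.
by rewrite !horner_quadM sqrrN !expr1n subrr !mul0r subrr.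
Qed.

(* The pole of the kernel is cancelled by [z%:P - 'X], which leaves
   (1 - x^2) v'(x) w(x) = - (1 - x^2) w'(x); the integrability of this term
   comes from that of the kernel. *)
Lemma ladder_kernel_by_parts (z : R) q : z \in `]-1, 1[ ->
  mu.-integrable `[-1, 1] (EFin \o w) ->
  mu.-integrable `[-1, 1] (EFin \o (fun x => ladder_kernel w z x * w x)) ->
  \int[mu]_(x in `[-1, 1]) (((z%:P - 'X) * q).[x] * (ladder_kernel w z x * w x))
  = (1 - z ^+ 2) * derive1 (potential w) z
      * \int[mu]_(x in `[-1, 1]) (q.[x] * w x)
    - \int[mu]_(x in `[-1, 1]) (((1 - 'X^2) * q)^`().[x] * w x).
Proof.
move=> zI wi Ki; set g := (1 - z ^+ 2) * _.
have qwi := integrable_horner_mul q wi.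
have KE (x : R) : `[-1, 1]%classic x -> ((1 - 'X^2) * q).[x] * dw x =
    ((z%:P - 'X) * q).[x] * (ladder_kernel w z x * w x) - g * (q.[x] * w x).
  rewrite /= in_itv /= => /andP[x1 x2].
  rewrite horner_quadM hornerM hornerD hornerC hornerN hornerX.
  rewrite /ladder_kernel -/g.
  (* The default value of the kernel at x = z is multiplied by z - x = 0, so the identity holds
     there too. *)
  have [->|xz] := eqVneq x z.
    rewrite subrr !mul0r sub0r /g potential_deriv//.
    by field; rewrite gt_eqF// jacobi_weight_gt0.
  have zx : z - x != 0 by rewrite subr_eq0 eq_sym.
  have [xI|xI] := boolP (x \in `]-1, 1[).
    rewrite potential_deriv//; field.
    by rewrite zx gt_eqF// jacobi_weight_gt0.
  (* At the endpoints nothing is known about v', but it enters only through (1 - x^2) v'(x). *)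
  have -> : 1 - x ^+ 2 = 0.
    move: xI; rewrite in_itv /= negb_and -!leNgt => /orP[xl|xr].
      by rewrite (_ : x = -1) ?sqrrN ?expr1n ?subrr//; apply/eqP; rewrite eq_le xl.
    by rewrite (_ : x = 1) ?expr1n ?subrr//; apply/eqP; rewrite eq_le x2.
  by field.
have Kqi := integrable_horner_mul ((z%:P - 'X) * q) Ki.
have gqi : mu.-integrable `[-1, 1] (EFin \o (fun x => g * (q.[x] * w x))).
  exact: integrableZl qwi.
have dwi : mu.-integrable `[-1, 1]
    (EFin \o (fun x => ((1 - 'X^2) * q).[x] * dw x)).
  have KBi := eq_integrable _ _ _ _ (integrableB _ Kqi gqi); apply: KBi => // x.
  by rewrite inE => /KE /= ->; rewrite EFinB.
rewrite -(quad_integration_by_parts wi dwi).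
have -> : \int[mu]_(x in `[-1, 1]) (((1 - 'X^2) * q).[x] * dw x) =
    \int[mu]_(x in `[-1, 1])
      (((z%:P - 'X) * q).[x] * (ladder_kernel w z x * w x) - g * (q.[x] * w x)).
  by apply: eq_Rintegral => x; rewrite inE => /KE.
by rewrite RintegralB// RintegralZl// [RHS]addrC subrK.
Qed.

End JacobiWeight.

(** * Monic orthogonal polynomials for an abstract linear functional *)

Section OrthogonalPolynomials.
Variables (R : realType) (L : {scalar {poly R}}).
Variables (P : nat -> {poly R}) (h : nat -> R).
Hypothesis monP : forall n, P n \is monic.
Hypothesis sizeP : forall n, size (P n) = n.+1.
Hypothesis LPP : forall i j, L (P i * P j) = h i *+ (i == j).
Hypothesis h_neq0 : forall n, h n != 0.

(* Variables with defining equations rather than abbreviations: otherwise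
   rewriting exposes the subtraction inside [rec_alpha]. *)
Variables al be : nat -> R.
Hypothesis alE : forall n, al n = rec_alpha P n.
Hypothesis beE : forall n, be n = rec_beta h n.

Let LZ c p : L (c *: p) = c * L p. Proof. exact: linearZ. Qed.
Let LD p q : L (p + q) = L p + L q. Proof. exact: linearD. Qed.
Let LB p q : L (p - q) = L p - L q. Proof. exact: linearB. Qed.

Lemma coef_monicP n : (P n)`_n = 1.
Proof. by have /monicP := monP n; rewrite lead_coefE sizeP. Qed.

Lemma size_sub_lead n (q : {poly R}) :
  (size q <= n.+1)%N -> (size (q - q`_n *: P n)%R <= n)%N.
Proof.
move=> sq; apply/leq_sizeP => j nj; rewrite coefB coefZ.
move: nj; rewrite leq_eqVlt => /predU1P[<-|nj].
  by rewrite coef_monicP mulr1 subrr.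
rewrite (nth_default 0 (leq_trans sq nj)) (nth_default 0 (s := P n)) ?sizeP//.
by rewrite mulr0 subr0.
Qed.

Lemma orthogonal_low n (q : {poly R}) : (size q <= n)%N -> L (q * P n) = 0.
Proof.
(* Induction on a size bound [m] with [n] fixed: removing a multiple of P_m, which is orthogonal to
   P_n, lowers the size. *)
have H m : forall q : {poly R}, (size q <= m <= n)%N -> L (q * P n) = 0.
  elim: m => [|m IH] p.
    by rewrite leqn0 size_poly_eq0 => /andP[/eqP-> _]; rewrite mul0r linear0.
  case/andP=> sp mn.
  have -> : p = (p - p`_m *: P m) + p`_m *: P m by rewrite subrK.
  rewrite mulrDl linearD /= IH; last by rewrite size_sub_lead//= ltnW.
  by rewrite -scalerAl LZ LPP ltn_eqF// mulr0n mulr0 addr0.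
by move=> sq; apply: (H n); rewrite sq /=.
Qed.

Lemma orthogonal_lead n (q : {poly R}) :
  (size q <= n.+1)%N -> L (q * P n) = q`_n * h n.
Proof.
move=> sq; have -> : q = (q - q`_n *: P n) + q`_n *: P n by rewrite subrK.
rewrite mulrDl linearD /= orthogonal_low ?size_sub_lead// add0r.
rewrite -scalerAl LZ LPP eqxx mulr1n; congr (_ * _).
by rewrite subrK.
Qed.

(** Subtracting the top multiple of P_{n+1} does not change the pairing with P_n, but shifts the
    coefficient of X^n by a multiple of [subcoef P n.+1]. *)
Lemma orthogonal_sublead n (q : {poly R}) : (size q <= n.+2)%N ->
  L (q * P n) = (q`_n - q`_n.+1 * subcoef P n.+1) * h n.
Proof.
move=> sq; have -> : q = (q - q`_n.+1 *: P n.+1) + q`_n.+1 *: P n.+1.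
  by rewrite subrK.
rewrite mulrDl linearD /= orthogonal_lead ?size_sub_lead//.
rewrite -(scalerAl _ (P n.+1)) LZ LPP gtn_eqF// mulr0n mulr0 addr0.
by rewrite subrK coefB coefZ.
Qed.

(** Comparing coefficients shows that the difference [r] of the two sides has degree below n. If [r]
    had degree k, its pairing with P_k would be a nonzero multiple of h_k, whereas orthogonality and
    the choice of [be] make it 0. *)
Lemma three_term n :
  'X * P n = P n.+1 + al n *: P n + be n *: pre_term P n.
Proof.
apply/eqP; rewrite -subr_eq0; set r := (X in X == 0).
have coefpre j : (n <= j)%N -> (pre_term P n)`_j = 0.
  by case: n {r} => [|n] nj; rewrite ?coef0 ?nth_default ?sizeP.
have coefxP j : ('X * P n)`_j.+1 = (P n)`_j by rewrite coefXM.
have sr : (size r <= n)%N.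
  apply/leq_sizeP => j nj; rewrite /r coefB !coefD !coefZ (coefpre _ nj).
  rewrite mulr0 addr0.
  have [->|nj1] := eqVneq j n.
    rewrite coef_monicP mulr1 alE /rec_alpha coefXM {2}/subcoef.
    by case: (n) => [|m] /=; ring.
  have [->|nj2] := eqVneq j n.+1.
    by rewrite coefxP !coef_monicP (nth_default 0 (s := P n)) ?sizeP//; ring.
  case: j nj nj1 nj2 => [|j] nj nj1 nj2; first by lia.
  by rewrite coefxP !nth_default ?sizeP; [ring|lia..].
case: n @r coefpre coefxP sr => [|n] r coefpre coefxP sr.
  by rewrite -size_poly_eq0 -leqn0.
apply/negPn/negP => r0.
have sr0 : (0 < size r)%N by rewrite size_poly_gt0.
pose k := (size r).-1.
have kn : (k <= n)%N by rewrite /k; lia.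
have : L (r * P k) = lead_coef r * h k.
  by rewrite orthogonal_lead ?lead_coefE// /k prednK.
(* The factor X is moved onto P_k: then X P_k has degree at most n + 1 and pairs with P_{n+1} only
   through its coefficient of X^{n+1}. *)
have -> : L (r * P k) = L (('X * P k) * P n.+1) - L (P n.+2 * P k)
    - al n.+1 * L (P n.+1 * P k) - be n.+1 * L (P n * P k).
  rewrite /= -!LZ -!linearB/=; congr (L _).
  by rewrite /r /= -!mul_polyC; ring.
rewrite orthogonal_lead; last first.
  by rewrite mulrC size_mulX ?monic_neq0// sizeP; lia.
rewrite coefXM /= !LPP.
have -> : (n.+2 == k) = false by lia.
have -> : (n.+1 == k) = false by lia.
have -> : (P k)`_n = (n == k)%:R.
  have [->|nk] := eqVneq n k; first by rewrite coef_monicP.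
  by rewrite nth_default// sizeP; lia.
move=> /esym/eqP; rewrite beE /rec_beta /=.
have -> : (n == k)%:R * h n.+1 - h n.+2 *+ false - al n.+1 * (h n.+1 *+ false) -
   h n.+1 / h n * (h n *+ (n == k)) = 0.
  by rewrite -(mulr_natr (h n)) !mulr0n; field.
by rewrite mulf_eq0 lead_coef_eq0 (negbTE r0) (negbTE (h_neq0 _)).
Qed.

Lemma three_term_succ n :
  P n.+1 = ('X - (al n)%:P) * P n - (be n)%:P * pre_term P n.
Proof. by rewrite mulrBl three_term -!mul_polyC; ring. Qed.

Lemma three_term_deriv n :
  (P n.+1)^`() = P n + ('X - (al n)%:P) * (P n)^`()
                 - (be n)%:P * (pre_term P n)^`().
Proof.
rewrite three_term_succ derivB !derivM derivB derivX !derivC.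
by rewrite subr0 mul1r mul0r add0r.
Qed.

Lemma size_deriv_P n : (size (P n)^`() <= n)%N.
Proof. by rewrite -ltnS -[X in (_ < X)%N]sizeP lt_size_deriv// monic_neq0. Qed.

Lemma deriv_P0 : (P 0)^`() = 0.
Proof. by apply/eqP; rewrite -size_poly_leq0 size_deriv_P. Qed.

Lemma coef_quad_deriv n : ((1 - 'X^2) * (P n.+1)^`())`_n.+2 = - n.+1%:R.
Proof.
rewrite mulrBl mul1r coefB coefXnM /= subn2 /= !coef_deriv coef_monicP.
by rewrite nth_default ?sizeP// mul0rn sub0r.
Qed.

Lemma size_quad_deriv n (q : {poly R}) : (size q <= n)%N ->
  (size ((1 - 'X^2) * q)%R <= n.+2)%N.
Proof.
move=> sq; apply: (leq_trans (size_polyMleq _ _)).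
rewrite -subn1 leq_subLR add1n (@leq_add _ _ 3 n)//.
by rewrite (leq_trans (size_polyD _ _))// size_polyN size_polyXn size_poly1.
Qed.

Lemma beta_mul n : be n.+1 * h n = h n.+1.
Proof. by rewrite beE /rec_beta /= divfK. Qed.

Lemma L_preP n : L (pre_term P n * P n) = 0.
Proof.
by rewrite orthogonal_low//; case: n => [|n] /=; rewrite ?size_poly0 ?sizeP.
Qed.

Lemma L_preP_next n : L (pre_term P n * P n.+1) = 0.
Proof.
by rewrite orthogonal_low//; case: n => [|n] /=; rewrite ?size_poly0 ?sizeP.
Qed.

(** The factor [(0 < n)%:R] records that P_{-1} = 0, since the dummy [be 0] is not 0. *)
Lemma L_prepre n :
  be n * L (pre_term P n * pre_term P n) = (0 < n)%:R * h n.
Proof.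
case: n => [|n] /=; first by rewrite mul0r linear0 mulr0 mul0r.
by rewrite LPP eqxx mulr1n beta_mul mul1r.
Qed.

Lemma L_XPP n : L ('X * P n * P n) = al n * h n.
Proof.
rewrite three_term 2!mulrDl 2!LD -!scalerAl !LZ L_preP !LPP.
by rewrite eqxx gtn_eqF// mulr1n mulr0n; ring.
Qed.

Lemma L_quad_deriv_next n :
  L ((1 - 'X^2) * (P n)^`() * P n.+1) = - n%:R * h n.+1.
Proof.
rewrite orthogonal_lead; last by rewrite size_quad_deriv ?size_deriv_P.
congr (_ * _); case: n => [|n]; last exact: coef_quad_deriv.
by rewrite deriv_P0 mulr0 coef0 oppr0.
Qed.

Lemma L_quad_deriv_pre n : L ((1 - 'X^2) * (pre_term P n)^`() * P n) =
  - (0 < n)%:R * (n%:R - 1) * h n.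
Proof.
case: n => [|n] /=; first by rewrite derivC mulr0 mul0r linear0; ring.
by rewrite L_quad_deriv_next -(natr1 n); ring.
Qed.

(** The two top coefficients of (1 - X^2) P_n' are -n at X^{n+1} and -(n - 1) [subcoef P n] at X^n;
    [orthogonal_sublead] combines them. *)
Lemma L_quad_deriv_self n : L ((1 - 'X^2) * (P n)^`() * P n) =
  (n%:R * subcoef P n.+1 - (n%:R - 1) * subcoef P n) * h n.
Proof.
rewrite orthogonal_sublead; last by rewrite size_quad_deriv ?size_deriv_P.
congr (_ * _); case: n => [|n].
  by rewrite deriv_P0 mulr0 !coef0 /=; ring.
rewrite coef_quad_deriv mulrBl mul1r coefB coefXnM !coef_deriv.
rewrite (nth_default 0 (s := P n.+1)) ?sizeP//.
case: n => [|n] /=; first by rewrite mul0rn; ring.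
rewrite subSS subn1 /= mul0rn -(mulr_natr _ n.+1) -(natr1 n.+1); ring.
Qed.

(** * The first two compatibility conditions, cleared of the denominator 1 - z^2 *)

Section Compatibility.
(* [M q] is the integral of [ladder_kernel w z * q * w]; [a n] and [b n] below
   are (1 - z^2) A_n(z) and (1 - z^2) B_n(z). *)
Variables (M : {scalar {poly R}}) (z g : R).
Hypothesis MK : forall q,
  M ((z%:P - 'X) * q) = g * L q - L (((1 - 'X^2) * q)^`()).

Let MZ c p : M (c *: p) = c * M p. Proof. exact: linearZ. Qed.

Let a n := (h n)^-1 * M (P n ^+ 2) + (2 * n%:R + 1).
Let b n := (h n.-1)^-1 * M (P n * pre_term P n) + (n%:R * z - subcoef P n).

(** The recurrence times P_n, with X - al_n written as (z - al_n) - (z - X), expresses the mixed [M]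
    terms by M(P_n^2) and M((z - X) P_n^2); [MK] evaluates the latter. *)
Lemma ladder_compat1 n : b n.+1 + b n = (z - al n) * a n - g.
Proof.
have E : M (P n.+1 * P n) + be n * M (P n * pre_term P n) =
    (z - al n) * M (P n ^+ 2) - M ((z%:P - 'X) * P n ^+ 2).
  rewrite -!MZ -linearD -linearB /=; congr (M _); rewrite -!mul_polyC.
  by rewrite three_term_succ polyCB; ring.
have D : ((1 - 'X^2) * P n ^+ 2)^`() =
    (-2) *: ('X * P n * P n) + 2 *: ((1 - 'X^2) * (P n)^`() * P n).
  rewrite !expr2 !derivM derivB derivC derivM derivX -!mul_polyC.
  by rewrite !polyCN polyC_natr; ring.
move: E; rewrite MK D LD !LZ expr2 LPP eqxx mulr1n.
rewrite L_XPP L_quad_deriv_self -expr2.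
rewrite /a /b succnK (_ : pre_term P n.+1 = P n)// => E.
(* This also holds at n = 0, where [be 0] is h_0 / h_0. *)
have -> : (h n.-1)^-1 = (h n)^-1 * be n.
  by rewrite beE /rec_beta mulrA mulVf ?mul1r.
have -> : M (P n.+1 * P n) = (z - al n) * M (P n ^+ 2) - (g * h n -
     ((-2) * (al n * h n) + 2 * ((n%:R * subcoef P n.+1 - (n%:R - 1) * subcoef P n)
     * h n))) - be n * M (P n * pre_term P n) by rewrite -E; ring.
by rewrite alE /rec_alpha -(natr1 n); field; rewrite h_neq0.
Qed.

Lemma ladder_compat2 n : (1 - z ^+ 2) + (z - al n) * (b n.+1 - b n) =
  be n.+1 * a n.+1 - be n * pre_term a n.
Proof.
(* As (X - al_n) P_n = P_{n+1} + be_n P_{n-1}, multiplying it by [D] gives a difference of squares: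
   only M(P_{n+1}^2) and M(P_{n-1}^2) appear, as needed for a_{n+1} and a_{n-1}. *)
pose D := P n.+1 - be n *: pre_term P n.
have E : (z - al n) * (M (P n.+1 * P n) - be n * M (P n * pre_term P n))
   - M (P n.+1 ^+ 2) + be n ^+ 2 * M (pre_term P n ^+ 2)
  = M ((z%:P - 'X) * (P n * D)).
  rewrite -!MZ -!linearB -MZ -!linearB -linearD /=; congr (M _).
  by rewrite /D -!mul_polyC three_term_succ polyCB polyC_exp; ring.
(* The differentiated recurrence makes the terms (1 - X^2) P_n' P_{n-1}, whose
   integral involves deeper coefficients of P_n, cancel. *)
have dE : ((1 - 'X^2) * (P n * D))^`() =
  (-2) *: (P n.+1 * P n.+1) + (- 2 * al n) *: (P n * P n.+1)
   + (2 * be n * al n) *: (pre_term P n * P n)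
   + (2 * be n ^+ 2) *: (pre_term P n * pre_term P n)
   + P n * P n -
   (P n.+1 * P n.+1 + (2 * al n) *: (P n * P n.+1) + (al n ^+ 2) *: (P n * P n)
    + (2 * be n) *: (pre_term P n * P n.+1)
    + (2 * be n * al n) *: (pre_term P n * P n)
    + (be n ^+ 2) *: (pre_term P n * pre_term P n))
   + 2 *: ((1 - 'X^2) * (P n)^`() * P n.+1)
   - (2 * be n) *: ((1 - 'X^2) * (pre_term P n)^`() * P n).
  rewrite /D -!mul_polyC expr2 !(derivM, derivB, derivX, derivC).
  rewrite three_term_deriv three_term_succ.
  rewrite !(polyCM, polyCN, polyC_natr, polyC_exp); ring.
have nSn : (n == n.+1) = false by lia.
have LPD : L (P n * D) = 0.
  rewrite /D mulrBr LB -scalerAr LZ LPP nSn mulr0n.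
  by rewrite [P n * _]mulrC L_preP; ring.
move: E; rewrite MK LPD dE !(LB, LD) !LZ !LPP nSn !eqxx !mulr1n !mulr0n.
rewrite L_preP L_preP_next L_quad_deriv_next L_quad_deriv_pre => E.
have hbe : be n.+1 = h n.+1 / h n by rewrite beE.
have bpa : be n * pre_term a n = be n ^+ 2 * (h n)^-1 * M (pre_term P n ^+ 2)
    + be n * ((0 < n)%:R * (2 * n%:R - 1)).
  rewrite /a; case: (n) => [|m] /=.
    by rewrite (expr2 (0 : {poly R})) mul0r linear0; ring.
  by rewrite -(natr1 m) beE /rec_beta /=; field; rewrite !h_neq0.
have hb : (h n.-1)^-1 = (h n)^-1 * be n.
  by rewrite beE /rec_beta mulrA mulVf ?mul1r.
rewrite bpa /a /b succnK (_ : pre_term P n.+1 = P n)// hb hbe.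
have {}E : M (P n.+1 ^+ 2) =
    (z - al n) * (M (P n.+1 * P n) - be n * M (P n * pre_term P n))
    + be n ^+ 2 * M (pre_term P n ^+ 2) - (2 * n%:R + 3) * h n.+1
    + (1 - al n ^+ 2) * h n + be n * ((0 < n)%:R * (2 * n%:R - 1) * h n).
  have -> : be n * ((0 < n)%:R * (2 * n%:R - 1) * h n) =
      be n * (be n * L (pre_term P n * pre_term P n))
      + 2 * be n * ((0 < n)%:R * (n%:R - 1) * h n) by rewrite L_prepre; ring.
  move/eqP: E; rewrite -subr_eq0 => /eqP E; apply/eqP; rewrite -subr_eq0.
  by apply/eqP; rewrite -[RHS]oppr0 -[in RHS]E; ring.
rewrite E -(natr1 n) (_ : subcoef P n.+1 = subcoef P n - al n); last first.
  by rewrite alE /rec_alpha; ring.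
by field; rewrite !h_neq0.
Qed.

End Compatibility.
End OrthogonalPolynomials.

(** * From the two conditions at a point to the sum rule and the ladder relations *)

Section LadderOfCompatibility.
Variables (R : realType) (z dv : R) (al be A B : nat -> R).
Variable P : nat -> {poly R}.
Hypothesis B0 : B 0%N = 0.
Hypothesis S1 : forall n, B n.+1 + B n = (z - al n) * A n - dv.
Hypothesis S2 : forall n, 1 + (z - al n) * (B n.+1 - B n)
  = be n.+1 * A n.+1 - be n * pre_term A n.

(** The increment of B_n^2 + dv B_n is (B_{n+1} + B_n + dv)(B_{n+1} - B_n). By [S1] the first factor
    is (z - al_n) A_n, so adding A_n gives A_n times the left side of [S2]. *)
Lemma compat_sum n :
  B n ^+ 2 + dv * B n + \sum_(0 <= j < n) A j = be n * A n * pre_term A n.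
Proof.
elim: n => [|n IH]; first by rewrite big_geq// B0 /=; ring.
rewrite big_nat_recr//=.
have -> : B n.+1 ^+ 2 + dv * B n.+1 + (\sum_(0 <= j < n) A j + A n) =
    (B n ^+ 2 + dv * B n + \sum_(0 <= j < n) A j) + A n
    + (B n.+1 + B n + dv) * (B n.+1 - B n) by ring.
rewrite IH S1 subrK.
have -> : be n * A n * pre_term A n + A n + (z - al n) * A n * (B n.+1 - B n)
  = be n * A n * pre_term A n + A n * (1 + (z - al n) * (B n.+1 - B n)) by ring.
by rewrite S2; ring.
Qed.

Hypothesis P0 : P 0%N = 1.
Hypothesis PS : forall n,
  P n.+1 = ('X - (al n)%:P) * P n - (be n)%:P * pre_term P n.

Let PSz n :
  (P n.+1).[z] = (z - al n) * (P n).[z] - be n * (pre_term P n).[z].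
Proof. by rewrite PS !hornerE. Qed.

Let dPSz n : (P n.+1)^`().[z] = (P n).[z] + (z - al n) * (P n)^`().[z]
  - be n * (pre_term P n)^`().[z].
Proof.
by rewrite PS derivB !derivM derivB derivX !derivC !hornerE; ring.
Qed.

Let raising_of_lowering n :
  (P n)^`().[z] = - B n * (P n).[z] + be n * A n * (pre_term P n).[z] ->
  (P n)^`().[z] = (B n.+1 + dv) * (P n).[z] - A n * (P n.+1).[z].
Proof.
move=> ->; rewrite PSz (_ : B n.+1 = (z - al n) * A n - dv - B n); first by ring.
by rewrite -S1 addrK.
Qed.

(** Both relations are proved together: differentiating the recurrence gives P_{n+1}' from P_n' and
    P_{n-1}', which are supplied by lowering and raising at n. *)
Lemma compat_ladder n :
  (P n)^`().[z] = - B n * (P n).[z] + be n * A n * (pre_term P n).[z] /\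
  (pre_term P n)^`().[z]
    = (B n + dv) * (pre_term P n).[z] - pre_term A n * (P n).[z].
Proof.
elim: n => [|n [lowering raising]].
  by rewrite P0 /= !derivC !horner0 B0; split; ring.
split; last exact: raising_of_lowering.
rewrite dPSz lowering raising PSz /=.
(* The term be_n A_{n-1} P_n is subtracted and added back to expose the right side of [S2]. *)
rewrite [RHS](_ : _ = (be n.+1 * A n.+1 - be n * pre_term A n) * (P n).[z]
  + be n * pre_term A n * (P n).[z]
  - B n.+1 * ((z - al n) * (P n).[z] - be n * (pre_term P n).[z])); last by ring.
rewrite -S2 (_ : B n = (z - al n) * A n - dv - B n.+1); first by ring.
by rewrite -S1 addrAC subrr add0r.
Qed.

End LadderOfCompatibility.

(** * Specialization to the Jacobi integrals *)

Theorem theorem4p1 (R : realType) (a b : R) (w0 : R -> R)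
    (P : nat -> {poly R}) (h : nat -> R) (z : R) :
  let w := jacobi_weight a b w0 in
  let dv : R -> R := derive1 (potential w) in
  let al := rec_alpha P in
  let be := rec_beta h in
  let A := ladderA w P h z in
  let B := ladderB w P h z in
  -1 < a -> -1 < b ->
  weight_factor w0 ->
  finite_moments w ->
  monic_orthogonal w P h ->
  z \in `]-1, 1[ ->
  ladder_convergent w P z ->
  (forall n : nat,
     (deriv (P n)).[z]
       = - B n * (P n).[z] + be n * A n * (pre_term P n).[z]) /\
  (forall n : nat,
     (deriv (pre_term P n)).[z]
       = (B n + dv z) * (pre_term P n).[z] - pre_term A n * (P n).[z]) /\
  (forall n : nat,
     B n.+1 + B n = (z - al n) * A n - dv z) /\
  (forall n : nat,
     1 + (z - al n) * (B n.+1 - B n)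
       = be n.+1 * A n.+1 - be n * pre_term A n) /\
  (forall n : nat, (1 <= n)%N ->
     B n ^+ 2 + dv z * B n + \sum_(0 <= j < n) A j
       = be n * A n * pre_term A n).
Proof.
move=> w dv al be A B a1 b1 w0P mom [monP sizeP orthP] zI [convA _].
have z2 : 1 - z ^+ 2 != 0.
  move: (zI); rewrite in_itv /= => /andP[z1 z2].
  by rewrite subr_eq0 eq_sym sqrf_eq1 negb_or (lt_eqF z2) (gt_eqF z1).
have w_gt0 := jacobi_weight_gt0 a b w0P.
have wi : (@lebesgue_measure R).-integrable `[-1, 1] (EFin \o w).
  rewrite (_ : w = (fun x => x ^+ 0 * w x)); first exact: mom.
  by apply/funext => x; rewrite expr0 mul1r.
have P0 : P 0%N = 1.
  have := monP 0%N; have /eqP/size_poly1P[c _ ->] := sizeP 0%N.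
  by rewrite monicE lead_coefC => /eqP->.
(* Since P_0 = 1, this is the convergence of the integral in A_0. *)
have Ki : (@lebesgue_measure R).-integrable `[-1, 1]
    (EFin \o (fun x => ladder_kernel w z x * w x)).
  rewrite (_ : (fun x => _) = ladderA_integrand w P 0 z); first exact: convA.
  by apply/funext => x; rewrite /ladderA_integrand P0 hornerC expr1n mulr1.
have [L LE] := weighted_integral_linear wi.
have [M ME] := weighted_integral_linear Ki.
have LPP i j : L (P i * P j) = h i *+ (i == j).
  by rewrite LE -orthP; apply: eq_Rintegral => x _; rewrite hornerM.
have h_neq0 n : h n != 0.
  have := LPP n n; rewrite eqxx mulr1n => <-; rewrite LE.
  exact: weighted_square_neq0 wi w_gt0 (monic_neq0 (monP n)).
pose g := (1 - z ^+ 2) * dv z.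
have MK q : M ((z%:P - 'X) * q) = g * L q - L (((1 - 'X^2) * q)^`()).
  by rewrite ME !LE; exact: ladder_kernel_by_parts.
have AE n : A n = (1 - z ^+ 2)^-1 *
    ((h n)^-1 * M (P n ^+ 2) + (2 * n%:R + 1)).
  rewrite /A /ladderA natrD natrM ME; congr (_ * (_ * _ + _)).
  apply: eq_Rintegral => x _.
  rewrite /ladderA_integrand horner_exp [RHS]mulrA.
  by rewrite [_ * ladder_kernel _ _ _]mulrC.
(* The formula includes n = 0: there [pre_term P 0] and [subcoef P 0] are 0, matching B_0 = 0. *)
have BE n : B n = (1 - z ^+ 2)^-1 *
    ((h n.-1)^-1 * M (P n * pre_term P n) + (n%:R * z - subcoef P n)).
  case: n => [|n]; first by rewrite /B /= mulr0 linear0 /=; ring.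
  rewrite /B /ladderB ME mulrDr mulrA [X in _ + X]mulrC; congr (_ * _ + _).
  apply: eq_Rintegral => x _.
  rewrite /ladderB_integrand hornerM [RHS]mulrA.
  by rewrite -[_ * _ * (pre_term _ _).[x]]mulrA [_ * ladder_kernel _ _ _]mulrC.
have alE n : al n = rec_alpha P n by [].
have beE n : be n = rec_beta h n by [].
have S1 n : B n.+1 + B n = (z - al n) * A n - dv z.
  have := ladder_compat1 monP sizeP LPP h_neq0 alE beE MK n.
  by rewrite !BE AE -mulrDr => ->; rewrite mulrBr mulKf// mulrCA.
have S2 n : 1 + (z - al n) * (B n.+1 - B n)
    = be n.+1 * A n.+1 - be n * pre_term A n.
  have := ladder_compat2 monP sizeP LPP h_neq0 alE beE MK n.
  have -> : pre_term (fun m => (h m)^-1 * M (P m ^+ 2) + (2 * m%:R + 1)) n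
      = (1 - z ^+ 2) * pre_term A n.
    by case: n => [|n] /=; rewrite ?mulr0// AE mulVKf.
  move=> E; apply: (mulfI z2); rewrite [RHS]mulrBr mulrDr mulr1.
  rewrite ![_ * (be _ * _)]mulrCA AE mulVKf// -E !BE -mulrBr.
  by rewrite [_ * ((z - al n) * _)]mulrCA mulVKf.
have B0 : B 0%N = 0 by [].
have PS := three_term_succ monP sizeP LPP h_neq0 alE beE.
have ladder n := compat_ladder B0 S1 S2 P0 PS n.
split; first by move=> n; have [] := ladder n.
split; first by move=> n; have [] := ladder n.
do 2![split=> //] => n _; exact: compat_sum.
Qed.
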